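(* For $\gamma\in(0,2)$ let $\Psi_\gamma(\xi,\eta)=\tfrac12(|\xi|^\gamma+|\eta|^\gamma-|\xi-\eta|^\gamma)$. For all positive integers $n,m$, $$\Psi_\gamma(n,-m)=\tfrac12\bigl(|n|^\gamma+|m|^\gamma-|n+m|^\gamma\bigr)\ \begin{cases}=0&\text{if }\gamma=1,\\>0&\text{if }\gamma<1,\\<0&\text{if }\gamma>1.\end{cases}$$ Consequently, $\gamma=1$ is the unique $\gamma\in(0,2)$ for which $\kappa_{\mathrm{real}}(\gamma)\ge1$, that is, for which $\Gamma_2(f,f)(x)\ge\Gamma(f,f)(x)$ holds for all real-valued trigonometric polynomials $f$ on $\mathbb{T}=\mathbb{R}/(2\pi\mathbb{Z})$ and all $x\in\mathbb{T}$, where $\Gamma$ and $\Gamma_2$ are the carré du champ and the iterated carré du champ of $L_\gamma=-(-\Delta)^{\gamma/2}$.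
   Context: $L_\gamma=-(-\Delta)^{\gamma/2}$ acts on $\mathbb{T}$ by $L_\gamma(e^{inx})=-|n|^\gamma e^{inx}$, $n\in\mathbb{Z}$. Its sesquilinear carré du champ $\Gamma$ (linear in the first argument, conjugate-linear in the second) satisfies $\Gamma(e^{in\cdot},e^{im\cdot})(x)=e^{i(n-m)x}\,\Psi_\gamma(n,m)$. For real-valued $f$, the iterated carré du champ is $\Gamma_2(f,f)=\tfrac12\bigl[L_\gamma(\Gamma(f,f))-2\Gamma(f,L_\gamma f)\bigr]$. The quantity $\kappa_{\mathrm{real}}(\gamma)$ is the Bakry–Émery curvature restricted to real-valued test functions: the supremum of real $\kappa$ such that $\Gamma_2(f,f)(x)\ge\kappa\,\Gamma(f,f)(x)$ for all real-valued trigonometric polynomials $f$ and all $x\in\mathbb{T}$. *)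

(* Defs.v *)
(* MathComp world: MathComp-Analysis, with the complex numbers R[i] of
   mathcomp-real-closed.

   Functions on the torus R/(2 pi Z) are written as functions R -> R[i];
   trigonometric polynomials are 2 pi-periodic. *)
From HB Require Import structures.
From mathcomp Require Import all_boot all_order all_algebra.
From mathcomp Require Import all_classical all_reals all_analysis.
From mathcomp Require Import complex.

Set Implicit Arguments.
Unset Strict Implicit.
Unset Printing Implicit Defensive.

Import Order.TTheory GRing.Theory Num.Theory.
Import numFieldNormedType.Exports.

Local Open Scope classical_set_scope.
Local Open Scope ring_scope.

Definition Psi (R : realType) (gamma xi eta : R) : R :=
  2^-1 * (`|xi| `^ gamma + `|eta| `^ gamma - `|xi - eta| `^ gamma).

(* x |-> e^{i n x} *)
Definition expi (R : realType) (n : int) (x : R) : R[i] :=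
  Complex (cos (n%:~R * x)) (sin (n%:~R * x)).

Definition trig_poly (R : realType) (f : R -> R[i]) : Prop :=
  exists (s : seq int) (c : int -> R[i]),
    forall x, f x = \sum_(n <- s) c n * expi n x.

Definition real_valued (R : realType) (f : R -> R[i]) : Prop :=
  forall x, complex.Im (f x) = 0.

(* The n-th Fourier coefficient, 1/(2 pi) \int_0^{2 pi} f(x) e^{-inx} dx. *)
Definition fourier (R : realType) (f : R -> R[i]) (n : int) : R[i] :=
  let g x := f x * expi (- n) x in
  let mean (h : R -> R) :=
    (2 * pi)^-1 * \int[lebesgue_measure]_(x in `[0, 2 * pi]) h x in
  Complex (mean (fun x => complex.Re (g x)))
          (mean (fun x => complex.Im (g x))).

(* L_gamma = -(-Delta)^{gamma/2}: the Fourier multiplier with symbol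
   -|n|^gamma.  The sum over all n : int is a finite-support sum: it is the
   intended one when only finitely many terms are nonzero, as is the case when
   f is a trigonometric polynomial, the only use made of it. *)
Definition L (R : realType) (gamma : R) (f : R -> R[i]) (x : R) : R[i] :=
  \sum_(n \in [set: int])
    - (`|n%:~R| `^ gamma)%:C%C * fourier f n * expi n x.

(* The sesquilinear carre du champ: Gamma (e^{in.}, e^{im.}) (x) is
   e^{i(n-m)x} Psi_gamma(n, m). *)
Definition Gamma (R : realType) (gamma : R) (f g : R -> R[i]) (x : R) : R[i] :=
  2^-1 * (L gamma (fun y => f y * (g y)^*) x
          - L gamma f x * (g x)^* - f x * (L gamma g x)^*).

(* The iterated carre du champ Gamma_2 (f, f), for f real valued. *)
Definition Gamma2 (R : realType) (gamma : R) (f : R -> R[i]) (x : R) : R[i] :=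
  2^-1 * (L gamma (Gamma gamma f f) x - 2 * Gamma gamma f (L gamma f) x).

(* The order of R[i] compares real parts of numbers with equal imaginary parts;
   for f real valued both sides are real. *)
Definition curvature_bound (R : realType) (gamma kappa : R) : Prop :=
  forall f : R -> R[i], trig_poly f -> real_valued f ->
  forall x, kappa%:C%C * Gamma gamma f f x <= Gamma2 gamma f x.

Definition kappa_real (R : realType) (gamma : R) : \bar R :=
  ereal_sup [set kappa%:E | kappa in [set k | curvature_bound gamma k]].

(* Main.v *)
Require Import Defs.
From mathcomp Require Import all_boot all_order all_algebra.
From mathcomp Require Import all_classical all_reals all_analysis.
From mathcomp Require Import complex.
From mathcomp Require Import ring lra zify.

Set Implicit Arguments.
Unset Strict Implicit.
Unset Printing Implicit Defensive.

Import Order.TTheory GRing.Theory Num.Theory.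
Import numFieldNormedType.Exports.

Local Open Scope classical_set_scope.
Local Open Scope ring_scope.

(** A trigonometric polynomial is a finite sum of a_i e^{i k_i x}, and on such
    sums the operators act on coefficients.  Orthogonality of the exponentials
    ([fourier_trig]) makes L the multiplier -|k|^gamma ([L_trig]), so the pair
    of frequencies (k, l) enters Gamma with weight Psi(k, l) ([Gamma_trig]).
    For real-valued f one has Gamma(f, L f) = Gamma(L f, f), so
    Gamma(f, L f) may be symmetrized in Gamma_2, and the same pair then enters
    Gamma_2(f, f) with weight Psi(k, l)^2 ([Gamma2_trig]).  The inequality
    Gamma_2 >= Gamma thus compares the kernels Psi^2 and Psi.

    For gamma = 1 the kernel Psi(k, l) is min(|k|, |l|) when k and l have the
    same strict sign, and 0 otherwise.  For natural numbers p and q,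
    min(p, q)^2 - min(p, q) is the sum over t >= 0 of 2 t [t < p] [t < q], so
    Psi^2 - Psi is a nonnegative combination of rank one kernels
    ([Psi1_sqrB]), and Gamma_2 - Gamma is a nonnegative combination of squared
    moduli ([Gamma_le_Gamma2_at1]).

    For gamma <> 1 the two kernels already differ the wrong way on
    f = 2 cos.  With c = Psi(1, -1), which is nonzero by the strict sub- or
    superadditivity of t |-> t^gamma ([Psi_opp_sign]) and is less than 1,
    Gamma(f, f) = 2 (1 + c cos 2x) and Gamma_2(f, f) = 2 (1 + c^2 cos 2x).
    Taking x = 0 or x = pi / 2, whichever gives w = cos 2x the sign of c, every
    curvature bound is at most (1 + w c^2) / (1 + w c) < 1.  This bound does
    not depend on the admissible curvature, so the supremum kappa_real is
    also less than 1 ([curvature_lt1]). *)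

(** * Means over a period *)

(** The mean is recorded through a primitive rather than through the integral:
    linear combinations are then immediate, and integrability never has to be
    discussed. *)
Definition has_mean (R : realType) (h : R -> R) (v : R) : Prop :=
  continuous h /\
  exists2 H : R -> R,
    forall x : R, is_derive x 1 H (h x) & H (2 * pi) - H 0 = 2 * pi * v.

Lemma twopi_gt0 (R : realType) : 0 < 2 * pi :> R.
Proof. by rewrite mulr_gt0 ?pi_gt0. Qed.

Lemma continuous_is_derive (R : realType) (f df : R -> R) :
  (forall x : R, is_derive x 1 f (df x)) -> continuous f.
Proof.
move=> fd x; apply/differentiable_continuous/derivable1_diffP.
by have [] := fd x.
Qed.

Lemma has_mean_Rintegral (R : realType) (h : R -> R) (v : R) :
  has_mean h v ->
  (2 * pi)^-1 * \int[lebesgue_measure]_(x in `[0, 2 * pi]) h x = v.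
Proof.
move=> [ch [H dH Hv]].
have cH := continuous_is_derive dH.
rewrite /Rintegral (@continuous_FTC2 _ h H) ?twopi_gt0//.
- by rewrite -EFinB /= Hv mulKf// gt_eqF ?twopi_gt0.
- exact: continuous_subspaceT.
- split.
  + by move=> x _; have [] := dH x.
  + exact/cvg_at_right_filter/cH.
  + exact/cvg_at_left_filter/cH.
- by move=> x _; rewrite derive1E; have [] := dH x.
Qed.

Lemma has_mean0 (R : realType) : has_mean (fun=> 0 : R) (0 : R).
Proof.
split; first exact: cst_continuous.
by exists (fun=> 0) => [x|]; rewrite ?subrr ?mulr0//; exact: is_derive_cst.
Qed.

Lemma has_meanD (R : realType) (g h : R -> R) (u v : R) :
  has_mean g u -> has_mean h v -> has_mean (fun x => g x + h x) (u + v).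
Proof.
move=> [cg [G dG Gu]] [ch [H dH Hv]]; split.
  by move=> x; apply: continuousD; [exact: cg|exact: ch].
exists (G + H) => [x|]; first exact: is_deriveD.
by rewrite [RHS]mulrDr -[X in _ = X + _]Gu -[X in _ = _ + X]Hv /= opprD addrACA.
Qed.

Lemma has_meanZ (R : realType) (a : R) (h : R -> R) (v : R) :
  has_mean h v -> has_mean (fun x => a * h x) (a * v).
Proof.
move=> [ch [H dH Hv]]; split.
  by move=> x; apply: continuousM; [exact: cst_continuous|exact: ch].
exists (a \*: H) => [x|]; first exact: is_deriveZ.
by rewrite [RHS]mulrCA -[X in _ = _ * X]Hv [RHS]mulrBr.
Qed.

Lemma has_mean_sum (R : realType) (I : Type) (r : seq I) (h : I -> R -> R)
    (v : I -> R) :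
  (forall i, has_mean (h i) (v i)) ->
  has_mean (fun x => \sum_(i <- r) h i x) (\sum_(i <- r) v i).
Proof.
move=> hv; elim: r => [|i r IH].
  by under eq_fun do rewrite big_nil; rewrite big_nil; exact: has_mean0.
under eq_fun do rewrite big_cons.
by rewrite big_cons; exact: has_meanD.
Qed.

Lemma is_derive_mull (R : realType) (k x : R) :
  is_derive x 1 (fun y => k * y) k.
Proof.
have := is_deriveZ k (is_derive_id x (1 : R)).
by rewrite -[k *: 1]/(k * 1) mulr1.
Qed.

Lemma cos_twopi_int (R : realType) (k : int) : cos (k%:~R * (2 * pi)) = 1 :> R.
Proof.
have E n : cos (n%:R * (2 * pi)) = 1 :> R.
  have -> : n%:R * (2 * pi) = 0 + (pi *+ 2) *+ n :> R.
    by rewrite add0r -[RHS]mulr_natl -[pi *+ 2]mulr_natl.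
  by rewrite periodicn ?cos0//; exact: cosD2pi.
by case: k => n; [exact: E|rewrite NegzE mulrNz mulNr cosN E].
Qed.

Lemma sin_twopi_int (R : realType) (k : int) : sin (k%:~R * (2 * pi)) = 0 :> R.
Proof.
have E n : sin (n%:R * (2 * pi)) = 0 :> R.
  have -> : n%:R * (2 * pi) = 0 + (pi *+ 2) *+ n :> R.
    by rewrite add0r -[RHS]mulr_natl -[pi *+ 2]mulr_natl.
  by rewrite periodicn ?sin0//; exact: sinD2pi.
by case: k => n; [exact: E|rewrite NegzE mulrNz mulNr sinN E oppr0].
Qed.

Lemma has_mean_cos (R : realType) (k : int) :
  has_mean (fun x : R => cos (k%:~R * x)) (k == 0)%:R.
Proof.
split.
  apply: (@continuous_is_derive _ _ (fun x => - sin (k%:~R * x) * k%:~R)) => x.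
  exact: (is_derive1_comp (is_derive_cos _) (is_derive_mull k%:~R x)).
have [->|k0] := eqVneq k 0.
  exists id => [x|]; last by rewrite subr0 mulr1.
  by rewrite mul0r cos0; exact: is_derive_id.
have kR : k%:~R != 0 :> R by rewrite intr_eq0.
exists (k%:~R^-1 \*: (sin \o (fun y => k%:~R * y))) => [x|].
  have := is_deriveZ k%:~R^-1
    (is_derive1_comp (is_derive_sin _) (is_derive_mull k%:~R x)).
  by rewrite -[_ *: _]/(_ * _) mulrCA mulVf ?mulr1.
by rewrite /= sin_twopi_int mulr0 sin0 subrr mulr0.
Qed.

Lemma has_mean_sin (R : realType) (k : int) :
  has_mean (fun x : R => sin (k%:~R * x)) 0.
Proof.
split.
  apply: (@continuous_is_derive _ _ (fun x => cos (k%:~R * x) * k%:~R)) => x.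
  exact: (is_derive1_comp (is_derive_sin _) (is_derive_mull k%:~R x)).
have [->|k0] := eqVneq k 0.
  exists (fun=> 0) => [x|]; last by rewrite subr0 mulr0.
  by rewrite mul0r sin0; exact: is_derive_cst.
have kR : k%:~R != 0 :> R by rewrite intr_eq0.
exists ((- k%:~R^-1) \*: (cos \o (fun y => k%:~R * y))) => [x|].
  have := is_deriveZ (- k%:~R^-1)
    (is_derive1_comp (is_derive_cos _) (is_derive_mull k%:~R x)).
  rewrite -[_ *: _]/(_ * _).
  by rewrite (_ : - k%:~R^-1 * (_ * _) = sin (k%:~R * x))//=; field.
by rewrite /= cos_twopi_int !mulr0 cos0 subrr.
Qed.

(** * The multiplier L on trigonometric sums *)

Lemma expi0 (R : realType) (x : R) : expi 0 x = 1.
Proof. by rewrite /expi mul0r cos0 sin0. Qed.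

Lemma expiD (R : realType) (m n : int) (x : R) :
  expi (m + n) x = expi m x * expi n x.
Proof.
apply/eqP; rewrite eq_complex /= intrD mulrDl cosD sinD eqxx /=.
by rewrite addrC mulrC [X in _ + X]mulrC addrC eqxx.
Qed.

Lemma expiC (R : realType) (n : int) (x : R) : (expi n x)^* = expi (- n) x.
Proof.
by apply/eqP; rewrite eq_complex /= mulrNz mulNr cosN sinN !eqxx.
Qed.

Lemma has_mean_Re_expi (R : realType) (a : R[i]) (m : int) :
  has_mean (fun x => complex.Re (a * expi m x)) (complex.Re (a * (m == 0)%:R)).
Proof.
have -> : complex.Re (a * (m == 0)%:R) =
    complex.Re a * (m == 0)%:R + - complex.Im a * 0.
  case: a => u v; case: (m == 0) => /=;
    by rewrite /= ?mulr0 ?mulr1 ?subr0 ?addr0.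
under eq_fun => x.
  have -> : complex.Re (a * expi m x) =
      complex.Re a * cos (m%:~R * x) + - complex.Im a * sin (m%:~R * x).
    by case: a => u v; rewrite /= mulNr.
  over.
by apply: has_meanD; apply: has_meanZ;
  [exact: has_mean_cos|exact: has_mean_sin].
Qed.

Lemma has_mean_Im_expi (R : realType) (a : R[i]) (m : int) :
  has_mean (fun x => complex.Im (a * expi m x)) (complex.Im (a * (m == 0)%:R)).
Proof.
have -> : complex.Im (a * (m == 0)%:R) =
    complex.Re a * 0 + complex.Im a * (m == 0)%:R.
  case: a => u v; case: (m == 0) => /=;
    by rewrite /= ?mulr0 ?mulr1 ?add0r ?addr0.
under eq_fun => x.
  have -> : complex.Im (a * expi m x) =
      complex.Re a * sin (m%:~R * x) + complex.Im a * cos (m%:~R * x).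
    by case: a => u v.
  over.
by apply: has_meanD; apply: has_meanZ;
  [exact: has_mean_sin|exact: has_mean_cos].
Qed.

(** Frequencies are allowed to repeat and are indexed by an arbitrary type, so
    that a product of two sums is again one, indexed by pairs. *)
Definition trig (R : realType) (I : Type) (r : seq I) (a : I -> R[i])
    (k : I -> int) (x : R) : R[i] := \sum_(i <- r) a i * expi (k i) x.

(** The product with e^{-inx} shifts each frequency to k_i - n, and only the
    frequency zero has a nonzero mean. *)
Lemma fourier_trig (R : realType) (I : Type) (r : seq I) (a : I -> R[i])
    (k : I -> int) (n : int) :
  fourier (trig r a k) n = \sum_(i <- r) a i * (k i == n)%:R.
Proof.
have fE x : trig r a k x * expi (- n) x =
    \sum_(i <- r) a i * expi (k i - n) x.
  by rewrite mulr_suml; apply: eq_bigr => i _; rewrite expiD mulrA.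
rewrite /fourier.
under [X in Complex (_ * Rintegral _ _ X) _]eq_fun do rewrite fE raddf_sum.
under [X in Complex _ (_ * Rintegral _ _ X)]eq_fun do rewrite fE raddf_sum.
under [RHS]eq_bigr do rewrite -subr_eq0.
rewrite (has_mean_Rintegral (has_mean_sum _ (fun i => has_mean_Re_expi _ _))).
rewrite (has_mean_Rintegral (has_mean_sum _ (fun i => has_mean_Im_expi _ _))).
by rewrite -!raddf_sum; case: (\sum_(_ <- _) _).
Qed.

Lemma L_trig (R : realType) (g : R) (I : eqType) (r : seq I) (a : I -> R[i])
    (k : I -> int) :
  L g (trig r a k) = trig r (fun i => - (`|(k i)%:~R| `^ g)%:C%C * a i) k.
Proof.
apply/funext => x; rewrite /L; under eq_fsbigr do rewrite fourier_trig.
rewrite (fsbigE (undup (map k r))) ?undup_uniq//; last first.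
  move=> n _; rewrite mem_undup => nr.
  rewrite big1_seq ?mulr0 ?mul0r// => i /andP[_ ir].
  have /negPf-> : k i != n by apply: contraNneq nr => <-; exact: map_f.
  by rewrite mulr0.
under eq_bigl do rewrite in_setT.
under eq_bigr do rewrite mulr_sumr mulr_suml.
rewrite exchange_big /= /trig big_seq [RHS]big_seq; apply: eq_bigr => i ir.
rewrite (bigD1_seq (k i)) ?undup_uniq ?mem_undup ?map_f//= eqxx mulr1.
rewrite big1 ?addr0// => n /negPf; rewrite eq_sym => ->.
by rewrite !mulr0 mul0r.
Qed.

(** * The sign of Psi at frequencies of opposite signs *)

(** Used with r = gamma - 1 for gamma < 1, where t^gamma = t * t^r. *)
Lemma powR_lt_neg (R : realType) (a b r : R) :
  0 < a -> a < b -> r < 0 -> b `^ r < a `^ r.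
Proof.
move=> a0 ab r0; have b0 := lt_trans a0 ab.
rewrite /powR !gt_eqF// ltr_expR ltr_nM2l// ltr_ln//.
Qed.

(** The factor t^(g - 1) in t^g = t * t^(g - 1) decreases, so each of
    a * (a + b)^(g - 1) and b * (a + b)^(g - 1) is less than a^g and b^g. *)
Lemma powRD_lt (R : realType) (a b g : R) :
  0 < a -> 0 < b -> 0 < g -> g < 1 -> (a + b) `^ g < a `^ g + b `^ g.
Proof.
move=> a0 b0 g0 g1.
have E x : 0 < x -> x `^ g = x * x `^ (g - 1).
  by move=> x0; rewrite mulr_powRB1 ?ltW.
rewrite !E ?addr_gt0// mulrDl.
by apply: ltrD; rewrite ltr_pM2l//; apply: powR_lt_neg; lra.
Qed.

Lemma powRD_gt (R : realType) (a b g : R) :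
  0 < a -> 0 < b -> 1 < g -> a `^ g + b `^ g < (a + b) `^ g.
Proof.
move=> a0 b0 g1.
have E x : 0 < x -> x `^ g = x * x `^ (g - 1).
  by move=> x0; rewrite mulr_powRB1 ?ltW//; lra.
rewrite !E ?addr_gt0// mulrDl.
by apply: ltrD; rewrite ltr_pM2l// gt0_ltr_powR ?nnegrE; lra.
Qed.

Lemma Psi_opp (R : realType) (g a b : R) :
  Psi g a (- b) = 2^-1 * (`|a| `^ g + `|b| `^ g - `|a + b| `^ g).
Proof. by rewrite /Psi normrN opprK. Qed.

Lemma Psi_opp_sign (R : realType) (g a b : R) : 0 < a -> 0 < b -> 0 < g ->
  [/\ g = 1 -> Psi g a (- b) = 0, g < 1 -> 0 < Psi g a (- b)
    & 1 < g -> Psi g a (- b) < 0].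
Proof.
move=> a0 b0 g0; rewrite Psi_opp !gtr0_norm ?addr_gt0//; split.
- by move=> ->; rewrite !powRr1 ?addr_ge0 ?ltW//; lra.
- by move=> g1; have := powRD_lt a0 b0 g0 g1; lra.
- by move=> g1; have := powRD_gt a0 b0 g1; lra.
Qed.

(** * Gamma and Gamma_2 on trigonometric sums *)

Lemma conjc_fixedP (R : realType) (z : R[i]) : complex.Im z = 0 <-> z^* = z.
Proof.
split=> [|/eqP].
  by case: z => u v /= ->; apply/eqP; rewrite eq_complex /= oppr0 !eqxx.
rewrite eq_complex => /andP[_ /eqP]; case: z => u v /=; lra.
Qed.

Lemma conj_real_complex (R : realType) (u : R) : (u%:C%C)^* = u%:C%C.
Proof. exact/conjc_fixedP. Qed.

Lemma trig_conj (R : realType) (I : Type) (r : seq I) (a : I -> R[i])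
    (k : I -> int) (x : R) :
  (trig r a k x)^* = trig r (fun i => (a i)^*) (fun i => - k i) x.
Proof.
by rewrite /trig rmorph_sum /=; apply: eq_bigr => i _; rewrite rmorphM/= expiC.
Qed.

(** A real-valued sum equals its conjugate, whose frequencies are opposite, and
    the symbol -|k|^gamma is real and even. *)
Lemma L_trig_real (R : realType) (g : R) (I : eqType) (r : seq I)
    (a : I -> R[i]) (k : I -> int) :
  real_valued (trig r a k) -> real_valued (L g (trig r a k)).
Proof.
move=> fr x; apply/conjc_fixedP.
have fE : trig r a k = trig r (fun i => (a i)^*) (fun i => - k i).
  by apply/funext => y; rewrite -trig_conj; apply/esym/conjc_fixedP.
rewrite [in RHS]fE !L_trig trig_conj /trig; apply: eq_bigr => i _.
by rewrite rmorphM rmorphN /= conj_real_complex mulrNz normrN.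
Qed.

Lemma Gamma_sym (R : realType) (g : R) (f h : R -> R[i]) :
  real_valued f -> real_valued h ->
  real_valued (L g f) -> real_valued (L g h) -> Gamma g f h = Gamma g h f.
Proof.
move=> fr hr Lfr Lhr; apply/funext => x; rewrite /Gamma.
have fhE : (fun y => f y * (h y)^*) = (fun y => h y * (f y)^*).
  apply/funext => y.
  by rewrite (conjc_fixedP _).1// ((conjc_fixedP (f y)).1 (fr y)) mulrC.
rewrite fhE ((conjc_fixedP _).1 (fr x)) ((conjc_fixedP _).1 (hr x)).
rewrite ((conjc_fixedP _).1 (Lfr x)) ((conjc_fixedP _).1 (Lhr x)).
by rewrite addrAC [f x * _]mulrC [h x * _]mulrC.
Qed.

Lemma trig_mul_conj (R : realType) (I J : Type) (r : seq I) (s : seq J)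
    (a : I -> R[i]) (b : J -> R[i]) (k : I -> int) (l : J -> int) (x : R) :
  trig r a k x * (trig s b l x)^* =
  trig [seq (i, j) | i <- r, j <- s] (fun p => a p.1 * (b p.2)^*)
    (fun p => k p.1 - l p.2) x.
Proof.
rewrite trig_conj /trig big_allpairs mulr_suml; apply: eq_bigr => i _.
rewrite mulr_sumr; apply: eq_bigr => j _ /=.
by rewrite expiD mulrACA.
Qed.

Lemma Psi_complex (R : realType) (g u v : R) :
  (Psi g u v)%:C%C = 2^-1 * ((`|u| `^ g)%:C%C + (`|v| `^ g)%:C%C
                             - (`|u - v| `^ g)%:C%C).
Proof. by rewrite /Psi rmorphM rmorphB rmorphD fmorphV rmorph_nat. Qed.

Lemma Gamma_trig (R : realType) (g : R) (I J : eqType) (r : seq I) (s : seq J)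
    (a : I -> R[i]) (b : J -> R[i]) (k : I -> int) (l : J -> int) :
  Gamma g (trig r a k) (trig s b l) =
  trig [seq (i, j) | i <- r, j <- s]
    (fun p => a p.1 * (b p.2)^* * (Psi g (k p.1)%:~R (l p.2)%:~R)%:C%C)
    (fun p => k p.1 - l p.2).
Proof.
apply/funext => x; rewrite /Gamma.
under eq_fun do rewrite trig_mul_conj.
rewrite !L_trig !trig_mul_conj /trig -!sumrB mulr_sumr.
apply: eq_bigr => -[i j] _ /=.
rewrite Psi_complex rmorphM rmorphN /= conj_real_complex intrB.
by field.
Qed.

(** Replacing 2 Gamma(f, L f) by Gamma(f, L f) + Gamma(L f, f) makes the weight
    of the pair (k, l) equal to
    (|k|^g + |l|^g - |k - l|^g) / 2 * Psi(k, l) = Psi(k, l)^2. *)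
Lemma Gamma2_trig (R : realType) (g : R) (I : eqType) (r : seq I)
    (a : I -> R[i]) (k : I -> int) :
  real_valued (trig r a k) ->
  Gamma2 g (trig r a k) =
  trig [seq (i, j) | i <- r, j <- r]
    (fun p => a p.1 * (a p.2)^* * (Psi g (k p.1)%:~R (k p.2)%:~R ^+ 2)%:C%C)
    (fun p => k p.1 - k p.2).
Proof.
move=> fr; have Lfr := L_trig_real g fr.
have LLfr : real_valued (L g (L g (trig r a k))).
  by rewrite L_trig; apply: L_trig_real; rewrite -L_trig.
apply/funext => x; rewrite /Gamma2 mulr_natl mulr2n.
rewrite [in X in _ - (_ + X)]Gamma_sym// !L_trig !Gamma_trig L_trig.
rewrite /trig -big_split /= -sumrB mulr_sumr.
apply: eq_bigr => -[i j] _ /=.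
rewrite rmorphXn /= Psi_complex rmorphM rmorphN /= conj_real_complex intrB.
by field.
Qed.

(** * The case gamma = 1: the kernel Psi^2 - Psi is positive semidefinite *)

Definition pos_part (m : int) : nat := `|Num.max m 0|%N.

(** At most one of the two minima is nonzero: the first when both frequencies
    are positive, the second when both are negative. *)
Lemma Psi1_int (R : realType) (m n : int) :
  Psi 1 m%:~R n%:~R =
  (minn (pos_part m) (pos_part n)
   + minn (pos_part (- m)) (pos_part (- n)))%:R :> R.
Proof.
rewrite /Psi !powRr1 ?normr_ge0// -intrB -!intr_norm -intrD -intrB.
suff -> : `|m| + `|n| - `|m - n| = 2 * (minn (pos_part m) (pos_part n)
    + minn (pos_part (- m)) (pos_part (- n)))%:Z :> int.
  by rewrite intrM mulKf.
rewrite /pos_part; lia.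
Qed.

Lemma sum_double_ltn (R : pzRingType) (u N : nat) : (u <= N)%N ->
  \sum_(t < N) t.*2%:R * (t < u)%N%:R = u%:R ^+ 2 - u%:R :> R.
Proof.
move=> uN; under eq_bigr do rewrite mulr_natr.
under eq_bigr do rewrite mulrb.
rewrite -big_mkcond -(big_ord_widen _ (fun t => t.*2%:R) uN).
rewrite -natr_sum; apply/eqP; rewrite eq_sym subr_eq -natrX -natrD; apply/eqP.
congr (_%:R); elim: u {uN} => [|u IH]; first by rewrite big_ord0.
by rewrite big_ord_recr -[in LHS]addn1 sqrnD IH /=; lia.
Qed.

(** The feature expansion behind positivity: Psi is u + v for two minima u and
    v with u v = 0, so Psi^2 - Psi = (u^2 - u) + (v^2 - v), and the indicator
    of t < min(p, q) is the product of those of t < p and t < q.  The bound N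
    only makes the range of t common to all frequencies of a sum. *)
Lemma Psi1_sqrB (R : realType) (N : nat) (m n : int) :
  (`|m| <= N)%N ->
  Psi 1 m%:~R n%:~R ^+ 2 - Psi 1 m%:~R n%:~R =
  \sum_(t < N) t.*2%:R *
    ((t < pos_part m)%N%:R * (t < pos_part n)%N%:R
     + (t < pos_part (- m))%N%:R * (t < pos_part (- n))%N%:R) :> R.
Proof.
move=> mN; rewrite Psi1_int.
set u := minn (pos_part m) _; set v := minn (pos_part (- m)) _.
have uv0 : u%:R * v%:R = 0 :> R.
  by rewrite -natrM (_ : (u * v = 0)%N)//; rewrite /u /v /pos_part; nia.
have uN : (u <= N)%N by rewrite /u /pos_part; lia.
have vN : (v <= N)%N by rewrite /v /pos_part; lia.
transitivity ((u%:R ^+ 2 - u%:R) + (v%:R ^+ 2 - v%:R) : R).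
  by rewrite natrD sqrrD uv0; ring.
rewrite -(sum_double_ltn _ uN) -(sum_double_ltn _ vN) -big_split /=.
by apply: eq_bigr => t _; rewrite -mulrDr -!natrM !mulnb -!leq_min.
Qed.

(** The double sum is the squared modulus of the sum of the b i * w i. *)
Lemma gram_ge0 (C : numClosedFieldType) (I : Type) (r : seq I) (b : I -> C)
    (w : I -> nat) :
  0 <= \sum_(i <- r) \sum_(j <- r) b i * (b j)^* * ((w i)%:R * (w j)%:R).
Proof.
suff -> : \sum_(i <- r) \sum_(j <- r) b i * (b j)^* * ((w i)%:R * (w j)%:R) =
    (\sum_(i <- r) b i * (w i)%:R) * (\sum_(i <- r) b i * (w i)%:R)^*.
  exact: mul_conjC_ge0.
rewrite rmorph_sum mulr_suml; apply: eq_bigr => i _.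
rewrite mulr_sumr; apply: eq_bigr => j _.
by rewrite rmorphM rmorph_nat mulrACA.
Qed.

Lemma Gamma_le_Gamma2_at1 (R : realType) (s : seq int) (c : int -> R[i])
    (x : R) :
  real_valued (trig s c id) ->
  Gamma 1 (trig s c id) (trig s c id) x <= Gamma2 1 (trig s c id) x.
Proof.
move=> fr; rewrite -subr_ge0 Gamma2_trig// Gamma_trig /trig -sumrB.
rewrite big_allpairs /=.
pose b i := c i * expi i x.
pose N := (\max_(i <- s) `|i|)%N.
(* e = 1 collects the positive frequencies, e = -1 the negative ones. *)
pose S (e : int) (t : nat) := \sum_(i <- s) \sum_(j <- s) b i * (b j)^*
  * ((t < pos_part (e * i))%N%:R * (t < pos_part (e * j))%N%:R).
suff -> : \sum_(i <- s) \sum_(j <- s)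
    (c i * (c j)^* * (Psi 1 i%:~R j%:~R ^+ 2)%:C%C * expi (i - j) x
     - c i * (c j)^* * (Psi 1 i%:~R j%:~R)%:C%C * expi (i - j) x) =
    \sum_(t < N) t.*2%:R * (S 1 t + S (-1) t).
  by apply: sumr_ge0 => t _; rewrite mulr_ge0// addr_ge0// gram_ge0.
rewrite /S; under [RHS]eq_bigr do rewrite -big_split mulr_sumr.
rewrite [RHS]exchange_big /= big_seq [RHS]big_seq; apply: eq_bigr => i si.
under [RHS]eq_bigr do rewrite -big_split mulr_sumr.
rewrite [RHS]exchange_big /=; apply: eq_bigr => j _.
have iN : (`|i| <= N)%N by exact: leq_bigmax_seq.
transitivity (b i * (b j)^* *
    (Psi 1 i%:~R j%:~R ^+ 2 - Psi 1 i%:~R j%:~R)%:C%C).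
  by rewrite /b [(c j * _)^*]rmorphM/= expiC expiD rmorphB /=; ring.
rewrite (Psi1_sqrB _ _ iN) rmorph_sum mulr_sumr; apply: eq_bigr => t _.
by rewrite !mul1r !mulN1r /=; ring.
Qed.

(** * The case gamma <> 1: the test function 2 cos *)

(** The points x = 0 and x = pi / 2 realize both extreme values of cos 2x. *)
Lemma expi2_sign (R : realType) (e : bool) :
  exists x : R, expi 2 x = (-1) ^+ e /\ expi (- 2) x = (-1) ^+ e.
Proof.
exists (if e then pi / 2 else 0); rewrite /expi mulrNz mulNr cosN sinN.
case: e => /=; last by rewrite mulr0 cos0 sin0 oppr0.
have -> : 2%:~R * (pi / 2) = pi :> R by field.
rewrite cospi sinpi oppr0; split; apply/eqP;
  by rewrite eq_complex /= oppr0 !eqxx.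
Qed.

(** The two exponentials of this sum add up to 2 cos. *)
Lemma cos_trig_real (R : realType) :
  real_valued (trig [:: 1; -1] (fun=> 1 : R[i]) id).
Proof.
move=> x; apply/conjc_fixedP; rewrite trig_conj /trig !big_cons !big_nil.
by rewrite conjC1 opprK !addr0 addrC.
Qed.

Lemma Psi_diag1 (R : realType) (g : R) : g != 0 ->
  Psi g 1 1 = 1 :> R /\ Psi g (-1) (-1) = 1.
Proof.
move=> g0; rewrite /Psi normrN1 normr1 !subrr normr0 powR0// powR1.
by split; lra.
Qed.

Lemma PsiC (R : realType) (g u v : R) : Psi g u v = Psi g v u.
Proof. by rewrite /Psi distrC [X in X - _]addrC. Qed.

(** The curvature inequality for f = 2 cos at a point where cos 2x = (-1)^e,
    with the common factor 2 removed. *)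
Lemma curvature_at_cos (R : realType) (g : R) (e : bool) (k : R) : g != 0 ->
  curvature_bound g k ->
  k * (1 + (-1) ^+ e * Psi g 1 (- 1)) <= 1 + (-1) ^+ e * Psi g 1 (- 1) ^+ 2.
Proof.
move=> g0 kb; have [x [xp xm]] := expi2_sign R e.
have tp : trig_poly (trig [:: 1; -1] (fun=> 1 : R[i]) id).
  by exists [:: 1; -1], (fun=> 1).
have := kb _ tp (@cos_trig_real R) x.
rewrite Gamma2_trig; last exact: cos_trig_real.
rewrite Gamma_trig /trig !big_cons !big_nil /=.
rewrite !subrr !expi0 !opprK -[1 + 1 : int]/(2 : int) -[- 1 - 1]/(- 2 : int).
rewrite xp xm.
have [P1 P2] := Psi_diag1 g0.
rewrite !mulrNz !mulr1z [Psi g (-1) 1]PsiC P1 P2 conjC1 !mulr1 !mul1r !addr0.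
set c := Psi g 1 _.
pose w : R := (-1) ^+ e.
have -> : (-1) ^+ e = w%:C%C by rewrite rmorphXn rmorphN1.
rewrite (_ : k%:C%C * _ = (k * (2 * (1 + w * c)))%:C%C); last first.
  by ring.
rewrite (_ : _ + (_ + _) = (2 * (1 + w * c ^+ 2))%:C%C); last first.
  by ring.
by rewrite lecR -/w; lra.
Qed.

(** With w the sign of c, so that w c = |c|, the inequality of
    [curvature_at_cos] bounds k by (1 + |c| c) / (1 + |c|), which is less than
    1 because 0 <> c < 1.  A bound uniform in k is needed to control the
    supremum of the admissible k. *)
Lemma curvature_lt1 (R : realType) (g : R) : 0 < g -> g != 1 ->
  exists2 k0 : R, k0 < 1 & forall k, curvature_bound g k -> k <= k0.
Proof.
move=> g0 g1; set c := Psi g 1 (- 1).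
have c0 : c != 0.
  have [_ clt cgt] := Psi_opp_sign (@ltr01 R) (@ltr01 R) g0.
  case: (ltgtP g 1) g1 => // [/clt cs|/cgt cs] _; first by rewrite gt_eqF.
  by rewrite lt_eqF.
have c1 : c < 1.
  rewrite /c Psi_opp normr1 powR1.
  have : 0 < `|1 + 1 : R| `^ g by rewrite powR_gt0 // gtr0_norm; lra.
  by lra.
pose w : R := (-1) ^+ (c < 0)%R.
have wc : 0 < w * c.
  by rewrite /w; case: (ltgtP c 0) c0 => // cs _; rewrite ?expr1 ?expr0; lra.
exists ((1 + w * c ^+ 2) / (1 + w * c)).
  rewrite ltr_pdivrMr; last lra.
  have := mulr_gt0 wc (_ : 0 < 1 - c); rewrite subr_gt0 => /(_ c1); lra.
move=> k kb; rewrite ler_pdivlMr; last lra.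
by apply: curvature_at_cos => //; rewrite gt_eqF.
Qed.

(** * The characterization of gamma = 1 *)

Lemma curvature_bound1P (R : realType) (g : R) : 0 < g ->
  curvature_bound g 1 <-> g = 1.
Proof.
move=> g0; split=> [b1|->].
  apply/eqP/negPn/negP => g1; have [k0 k01 /(_ _ b1)] := curvature_lt1 g0 g1.
  by rewrite leNgt k01.
move=> f [s [c fE]] fr x; have {fE} fE : f = trig s c id by apply/funext.
by rewrite mul1r fE; apply: Gamma_le_Gamma2_at1; rewrite -fE.
Qed.

Theorem theoremD (R : realType) :
  (forall gamma : R, 0 < gamma < 2 ->
   forall n m : nat, (0 < n)%N -> (0 < m)%N ->
     [/\ Psi gamma n%:R (- m%:R) =
           2^-1 * (`|n%:R : R| `^ gamma + `|m%:R : R| `^ gamma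
                   - `|n%:R + m%:R : R| `^ gamma),
         gamma = 1 -> Psi gamma n%:R (- m%:R) = 0,
         gamma < 1 -> 0 < Psi gamma n%:R (- m%:R)
       & 1 < gamma -> Psi gamma n%:R (- m%:R) < 0])
  /\ (forall gamma : R, 0 < gamma < 2 ->
      ((1%:E <= kappa_real gamma)%E <-> gamma = 1))
  /\ (forall gamma : R, 0 < gamma < 2 ->
      ((forall f : R -> R[i], trig_poly f -> real_valued f ->
        forall x : R, Gamma gamma f f x <= Gamma2 gamma f x)
       <-> gamma = 1)).
Proof.
split; [|split] => g /andP[g0 g2].
- move=> n m n0 m0.
  have [|| P1 Plt Pgt] := @Psi_opp_sign R g n%:R m%:R _ _ g0; rewrite ?ltr0n//.
  by split=> //; exact: Psi_opp.
- split=> [|/(curvature_bound1P g0) b1]; last first.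
    by apply: ereal_sup_ubound; exists 1.
  move=> k1; apply/eqP/negPn/negP => g1.
  have [k0 k01 k0P] := curvature_lt1 g0 g1.
  have : (kappa_real g <= k0%:E)%E.
    by apply: ge_ereal_sup => _ [k kb <-]; rewrite lee_fin; exact: k0P.
  by move=> /(le_trans k1); rewrite lee_fin leNgt k01.
- rewrite -(curvature_bound1P g0); split=> b1 f ft fr x.
    by rewrite mul1r; exact: b1.
  by rewrite -[leLHS]mul1r; exact: b1.
Qed.
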